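(* Let $\mathbf{n}\in\mathfrak{gl}_n(\mathbb{R})$ be a nilpotent matrix with nilpotency index $p\ge 2$ and let $\mathbf{m}$ be its conjugate transpose (in the sense defined in the context). Define $$\bar{\mathbf{n}}:=\mathbf{n},\qquad \bar{\mathbf{m}}:=\sum_{i=1}^{p-1}\sum_{l=0}^{i-1}\mathbf{n}^{l}\mathbf{m}^{i}\mathbf{n}^{i-l-1},\qquad \bar{\mathbf{h}}:=\sum_{i=1}^{p-1}\left[\mathbf{m}^{i},\mathbf{n}^{i}\right].$$ Then $\langle\bar{\mathbf{n}},\bar{\mathbf{h}},\bar{\mathbf{m}}\rangle$ is an $\mathfrak{sl}_2$-triple, i.e. $$[\bar{\mathbf{m}},\bar{\mathbf{n}}]=\bar{\mathbf{h}},\qquad [\bar{\mathbf{h}},\bar{\mathbf{n}}]=-2\bar{\mathbf{n}},\qquad [\bar{\mathbf{h}},\bar{\mathbf{m}}]=2\bar{\mathbf{m}}.$$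
   Context: $\mathfrak{gl}_n(\mathbb{R})$ is the space of real $n\times n$ matrices and $[A,B]=AB-BA$. The nilpotency index of a nilpotent matrix $\mathbf{n}$ is the least $p$ with $\mathbf{n}^p=0$. $A^0$ is the identity. Jordan normal form is upper triangular (ones and zeros on the superdiagonal). Conjugate transpose: let $\mathsf{N}$ be the Jordan normal form of $\mathbf{n}$ (block diagonal with nilpotent Jordan blocks), let $P\in GL_n(\mathbb{R})$ be an invertible matrix with $\mathbf{n}=P^{-1}\mathsf{N}P$, and let $\mathsf{M}=\mathsf{N}^{t}$ be the transpose of $\mathsf{N}$; then $\mathbf{m}:=P^{-1}\mathsf{M}P$. An $\mathfrak{sl}_2$-triple $\langle N,H,M\rangle$ satisfies $[M,N]=H$, $[H,N]=-2N$, $[H,M]=2M$. *)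

(* Defs.v *)
From mathcomp Require Import all_boot all_order all_algebra.
From mathcomp Require Import reals.

Set Implicit Arguments.
Unset Strict Implicit.
Unset Printing Implicit Defensive.

Import GRing.Theory.
Local Open Scope ring_scope.

(* [A ^+ 0] is the identity, and this is well defined for [n = 0] too, since
   ['M[R]_n] is a (possibly trivial) ring for every [n]. *)
Definition nilpotency_index (R : realType) (n : nat) (A : 'M[R]_n) (p : nat)
  : Prop :=
  A ^+ p = 0 /\ forall q : nat, (q < p)%N -> A ^+ q <> 0.

Definition lie_bracket (R : realType) (n : nat) (A B : 'M[R]_n) : 'M[R]_n :=
  A * B - B * A.

Definition nilpotent_jordan_block (R : realType) (k : nat) : 'M[R]_k :=
  \matrix_(i < k, j < k) (j == i.+1 :> nat)%:R.

(* The order of the blocks is left arbitrary, so that the Jordan normal form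
   of a nilpotent matrix is determined up to a permutation of its blocks; the
   cast only identifies the sum of the block sizes with [n]. *)
Definition nilpotent_jordan_form (R : realType) (n : nat) (N : 'M[R]_n)
  : Prop :=
  exists (k : nat) (d : 'I_k -> nat) (e : (\sum_(i < k) d i)%N = n),
    (forall i : 'I_k, (0 < d i)%N) /\
    N = castmx (e, e) (\mxdiag_(i < k) nilpotent_jordan_block R (d i)).

(* A relation, because the conjugate transpose of [A] depends on the choice of
   the matrix [P] which conjugates [A] to its Jordan normal form [N]. *)
Definition conjugate_transpose (R : realType) (n : nat) (A B : 'M[R]_n)
  : Prop :=
  exists N P : 'M[R]_n,
    [/\ nilpotent_jordan_form N,
        P \in unitmx,
        A = invmx P *m N *m P
      & B = invmx P *m N^T *m P].

Definition bar_m (R : realType) (n p : nat) (A B : 'M[R]_n) : 'M[R]_n :=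
  \sum_(1 <= i < p) \sum_(0 <= l < i) A ^+ l * B ^+ i * A ^+ (i - l - 1).

Definition bar_h (R : realType) (n p : nat) (A B : 'M[R]_n) : 'M[R]_n :=
  \sum_(1 <= i < p) lie_bracket (B ^+ i) (A ^+ i).

Definition sl2_triple (R : realType) (n : nat) (N H M : 'M[R]_n) : Prop :=
  [/\ lie_bracket M N = H,
      lie_bracket H N = (- 2%:R) *: N
    & lie_bracket H M = 2%:R *: M].

(* Main.v *)
(** Write N for [A] and M for [B]; the bracket of [bar_m] with N telescopes. Up
    to conjugation N is a 0-1 matrix with at most one 1 in each row and column,
    and M is its transpose, so N M N = N, M N M = M, and the products N^i M^i
    and M^i N^i are diagonal, hence commute with one another. It follows that
    N^(i+1) M^(i+1) N = N^(i+1) M^i and N M^(i+1) N^(i+1) = M^i N^(i+1), which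
    make the bracket of [bar_h] with N telescope to -2N. These relations are
    symmetric in N and M, and exchanging N and M negates [bar_h], so its
    bracket with M is 2M. Finally the bracket with [bar_h] is a derivation and
    every term of [bar_m] has one more factor M than N, so [bar_m] is an
    eigenvector for the eigenvalue 2. *)
Require Import Defs.
From mathcomp Require Import all_boot all_order all_algebra.
From mathcomp Require Import reals.
From mathcomp Require Import zify.

Set Implicit Arguments.
Unset Strict Implicit.
Unset Printing Implicit Defensive.

Import GRing.Theory.
Local Open Scope ring_scope.

(** Unlike the Jordan form, this shape is stable under transposition, so each result on [A] also
    serves for [A^T]. *)
Definition partial_perm_mx (R : pzRingType) (n : nat) (A : 'M[R]_n) : Prop :=
  exists e : rel 'I_n,
    [/\ forall i j, A i j = (e i j)%:R,
        forall i j k, e i j -> e i k -> j = k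
      & forall i j k, e i k -> e j k -> i = j].

Lemma partial_perm_mx_tr (R : pzRingType) (n : nat) (A : 'M[R]_n) :
  partial_perm_mx A -> partial_perm_mx A^T.
Proof.
case=> e [Ae er ec]; exists (fun i j => e j i); split=> [i j|i j k|i j k].
- by rewrite mxE Ae.
- exact: ec.
- exact: er.
Qed.

(** A nonzero term of entry [(i, j)] needs a column where rows [i] and [j] both have a 1, which
    forces [i = j]. *)
Lemma partial_perm_mx_conj_diag (R : pzRingType) (n : nat) (A D : 'M[R]_n) :
  partial_perm_mx A -> is_diag_mx D -> is_diag_mx (A *m D *m A^T).
Proof.
case=> e [Ae er ec] /is_diag_mxP dD; apply/is_diag_mxP => i j neq_ij.
rewrite mxE big1 // => k _; rewrite !mxE big_distrl big1 //= => l _.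
rewrite !Ae; have [->|neq_lk] := eqVneq l k; last first.
  by rewrite dD ?mulr0 ?mul0r.
case eik: (e i k); last by rewrite !mul0r.
case ejk: (e j k); last by rewrite mulr0.
by rewrite (ec _ _ _ eik ejk) eqxx in neq_ij.
Qed.

Lemma partial_perm_mx_mulK (R : pzRingType) (n : nat) (A : 'M[R]_n) :
  partial_perm_mx A -> A *m A^T *m A = A.
Proof.
case=> e [Ae er ec]; apply/matrixP => i j; rewrite -mulmxA mxE.
under eq_bigr => k _ do rewrite mxE big_distrr /=.
have [eij|neij] := boolP (e i j); last first.
  rewrite [RHS]Ae (negbTE neij) big1 // => k _; rewrite big1 // => l _.
  rewrite mxE !Ae; case eik: (e i k); last by rewrite mul0r.
  case elk: (e l k); last by rewrite mul0r mulr0.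
  by rewrite -(ec _ _ _ eik elk) (negbTE neij) !mulr0.
rewrite (bigD1 j) //= [X in _ + X]big1 ?addr0 => [|k neq_kj]; last first.
  rewrite big1 // => l _; rewrite !Ae; case eik: (e i k); last by rewrite mul0r.
  by rewrite (er _ _ _ eij eik) eqxx in neq_kj.
rewrite (bigD1 i) //= big1 ?addr0 => [|l neq_li]; last first.
  rewrite mxE !Ae; case elj: (e l j); last by rewrite mul0r mulr0.
  by rewrite (ec _ _ _ eij elj) eqxx in neq_li.
by rewrite mxE !Ae eij !mulr1.
Qed.

Lemma partial_perm_mx_expr_diag (R : pzRingType) (n : nat) (A : 'M[R]_n)
    (i : nat) :
  partial_perm_mx A -> is_diag_mx (A ^+ i * A^T ^+ i).
Proof.
move=> pA; elim: i => [|i IHi].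
  rewrite mulr1; apply/is_diag_mxP => j k /negbTE.
  by rewrite mxE -val_eqE => ->.
rewrite exprS exprSr mulrA -(mulrA A).
exact: partial_perm_mx_conj_diag.
Qed.

Lemma is_diag_mx_comm (R : comPzRingType) (n : nat) (A B : 'M[R]_n) :
  is_diag_mx A -> is_diag_mx B -> GRing.comm A B.
Proof.
by move=> /diag_mxP[a ->] /diag_mxP[b ->]; rewrite /GRing.comm; apply: diag_mxC.
Qed.

Lemma nilpotent_jordan_form_partial_perm (R : realType) (n : nat)
    (N : 'M[R]_n) :
  nilpotent_jordan_form N -> partial_perm_mx N.
Proof.
case=> k [d [en [_ ->]]]; case: n / en {N}; rewrite castmx_id.
(* An index amounts to a block and a position in it; positions are compared in [nat] because their
   type depends on the block. *)
have sigI (s t : 'I_(\sum_(i < k) d i)) : tagnat.sig1 s = tagnat.sig1 t ->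
    tagnat.sig2 s = tagnat.sig2 t :> nat -> s = t.
  move=> e1 e2; rewrite -[s]tagnat.sig2K -[t]tagnat.sig2K; apply: val_inj.
  by apply/eqP; rewrite tagnat.eq_Rank; apply/andP; split; apply/eqP.
exists (fun s t => (tagnat.sig1 s == tagnat.sig1 t)
  && (tagnat.sig2 t == (tagnat.sig2 s).+1 :> nat)); split=> [s t|s t u|s t u].
- rewrite !mxE.
  move: (tagnat.sig2 s) (tagnat.sig2 t).
  case: eqVneq => [->|_] i j; last by rewrite mxE.
  by rewrite conform_mx_id mxE.
- move=> /andP[/eqP e1 /eqP f1] /andP[/eqP e2 /eqP f2].
  by apply: sigI; rewrite -?e1 ?f1.
- move=> /andP[/eqP e1 /eqP f1] /andP[/eqP e2 /eqP f2].
  by apply: sigI; [rewrite e1 | apply: succn_inj; rewrite -f1 f2].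
Qed.

(** Modelled on an operator [x] with adjoint [y] all of whose powers are partial isometries.
    Diagonality is lost under conjugation by [P]; these relations are not. *)
Definition power_partial_isometry (R : pzRingType) (x y : R) : Prop :=
  [/\ x * y * x = x, y * x * y = y,
      forall i, GRing.comm (x * y) (y ^+ i * x ^+ i)
    & forall i, GRing.comm (y * x) (x ^+ i * y ^+ i)].

Lemma power_partial_isometry_sym (R : pzRingType) (x y : R) :
  power_partial_isometry x y -> power_partial_isometry y x.
Proof. by case. Qed.

Lemma power_partial_isometry_tr (R : comPzRingType) (n : nat) (A : 'M[R]_n) :
  partial_perm_mx A -> power_partial_isometry A A^T.
Proof.
move=> pA; have pA' := partial_perm_mx_tr pA.
have dA i : is_diag_mx (A ^+ i * A^T ^+ i) by apply: partial_perm_mx_expr_diag.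
have dA' i : is_diag_mx (A^T ^+ i * A ^+ i).
  by rewrite -{2}[A]trmxK; apply: partial_perm_mx_expr_diag.
split=> [||i|i]; try exact: is_diag_mx_comm (dA 1) (dA' i).
- exact: partial_perm_mx_mulK.
- by have := partial_perm_mx_mulK pA'; rewrite trmxK.
- exact: is_diag_mx_comm (dA' 1) (dA i).
Qed.

Lemma power_partial_isometry_conj (R : pzRingType) (u v x y : R) :
  u * v = 1 -> v * u = 1 -> power_partial_isometry x y ->
  power_partial_isometry (v * x * u) (v * y * u).
Proof.
move=> uv1 vu1 [xyx yxy cxy cyx].
have conjM a b : v * a * u * (v * b * u) = v * (a * b) * u.
  by rewrite !mulrA -(mulrA _ u) uv1 mulr1.
have conjX a i : (v * a * u) ^+ i = v * a ^+ i * u.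
  by elim: i => [|i IHi]; rewrite ?mulr1 // !exprS IHi conjM.
by split=> [||i|i]; rewrite /GRing.comm ?conjX !conjM ?xyx ?yxy ?cxy ?cyx.
Qed.

(** The trailing [y * x] commutes leftwards past [x ^+ i * y ^+ i] and is absorbed by the first [x],
    as [x * y * x = x]. *)
Lemma mul_expr_cancelr (R : pzRingType) (x y : R) (i : nat) :
  power_partial_isometry x y ->
  x ^+ i.+1 * y ^+ i.+1 * x = x ^+ i.+1 * y ^+ i.
Proof.
case=> xyx _ _ cyx; rewrite exprS exprSr.
have -> : x * x ^+ i * (y ^+ i * y) * x = x * (x ^+ i * y ^+ i * (y * x)).
  by rewrite !mulrA.
by rewrite -cyx !mulrA xyx.
Qed.

Lemma mul_expr_cancell (R : pzRingType) (x y : R) (i : nat) :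
  power_partial_isometry x y ->
  x * (y ^+ i.+1 * x ^+ i.+1) = y ^+ i * x ^+ i.+1.
Proof.
case=> xyx _ cxy _; rewrite exprS exprSr.
have -> : x * (y * y ^+ i * (x ^+ i * x)) = x * y * (y ^+ i * x ^+ i) * x.
  by rewrite !mulrA.
by rewrite cxy -!mulrA (mulrA x) xyx.
Qed.

Lemma power_partial_isometry_expr (R : pzRingType) (x y : R) (i : nat) :
  power_partial_isometry x y -> x ^+ i * y ^+ i * x ^+ i = x ^+ i.
Proof.
move=> pxy; elim: i => [|i IHi]; first by rewrite !mulr1.
rewrite {2}exprS mulrA mul_expr_cancelr // exprS.
by rewrite -!mulrA (mulrA (x ^+ i)) IHi.
Qed.

(** Since [y ^+ p = y ^+ p * x ^+ p * y ^+ p]. This allows [x] and [y] to be exchanged in the next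
    lemma. *)
Lemma power_partial_isometry_nil (R : pzRingType) (x y : R) (p : nat) :
  power_partial_isometry x y -> x ^+ p = 0 -> y ^+ p = 0.
Proof.
move=> /power_partial_isometry_sym/power_partial_isometry_expr <- ->.
by rewrite mulr0 mul0r.
Qed.

Lemma comm_sum_lie_powers (R : pzRingType) (x y : R) (p : nat)
    (h := \sum_(1 <= i < p) (y ^+ i * x ^+ i - x ^+ i * y ^+ i)) :
  power_partial_isometry x y -> (0 < p)%N -> x ^+ p = 0 ->
  h * x - x * h = - (x *+ 2).
Proof.
case: p @h => // p h pxy _ xp0.
(* Here [p] is one less than the original exponent: [f p] vanishes because it contains [x ^+ p.+1],
   and [f 0] is [x *+ 2]. *)
pose f i := y ^+ i * x ^+ i.+1 + x ^+ i.+1 * y ^+ i.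
have -> : h * x - x * h = \sum_(0 <= i < p) (f i.+1 - f i).
  rewrite /h big_add1 /= mulr_suml mulr_sumr -sumrB.
  apply: eq_bigr => i _; rewrite mulrBl mulrBr.
  rewrite mul_expr_cancelr // mul_expr_cancell // mulrA -exprS -mulrA -exprSr.
  by rewrite /f opprB opprD addrACA [- _ - _]addrC addrACA.
rewrite telescope_sumr // /f xp0 mulr0 mul0r addr0 sub0r.
by rewrite !expr0 mul1r mulr1.
Qed.

Definition ad_eigen (R : pzRingType) (h : R) (w : int) (x : R) : Prop :=
  h * x - x * h = x *~ w.

(** Leibniz rule: the two terms [x * h * y] cancel. *)
Lemma ad_eigenM (R : pzRingType) (h : R) (w1 w2 : int) (x y : R) :
  ad_eigen h w1 x -> ad_eigen h w2 y -> ad_eigen h (w1 + w2) (x * y).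
Proof.
rewrite /ad_eigen mulrzDr => hx hy.
rewrite -mulrzAl -[x * y *~ w2]mulrzAr -hx -hy mulrBl mulrBr !mulrA.
by rewrite addrA subrK.
Qed.

Lemma ad_eigenX (R : pzRingType) (h : R) (w : int) (x : R) (i : nat) :
  ad_eigen h w x -> ad_eigen h (w * i%:Z) (x ^+ i).
Proof.
move=> hx; elim: i => [|i IHi].
  by rewrite /ad_eigen mulr0 mulr1 mul1r subrr.
by rewrite exprS -add1n PoszD mulrDr mulr1; apply: ad_eigenM.
Qed.

Lemma ad_eigen_sum (R : pzRingType) (h : R) (w : int) (I : eqType) (r : seq I)
    (F : I -> R) :
  {in r, forall i, ad_eigen h w (F i)} -> ad_eigen h w (\sum_(i <- r) F i).
Proof.
move=> hF; rewrite /ad_eigen mulr_sumr mulr_suml -sumrB.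
by rewrite mulrz_suml; apply: eq_big_seq.
Qed.

Theorem theorem4p2 (R : realType) (n p : nat) (A B : 'M[R]_n)
    (hp : (2 <= p)%N)
    (hA : nilpotency_index A p)
    (hB : conjugate_transpose A B) :
  sl2_triple A (bar_h p A B) (bar_m p A B).
Proof.
have p_gt0 : (0 < p)%N by apply: ltnW.
have [Ap0 _] := hA.
have pAB : power_partial_isometry A B.
  case: hB => N [P [/nilpotent_jordan_form_partial_perm pN uP -> ->]].
  apply: power_partial_isometry_conj; [exact: mulmxV | exact: mulVmx |].
  exact: power_partial_isometry_tr.
have Bp0 := power_partial_isometry_nil pAB Ap0.
have hhA : ad_eigen (bar_h p A B) (- 2) A.
  exact: comm_sum_lie_powers pAB p_gt0 Ap0.
have hhB : ad_eigen (bar_h p A B) 2 B.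
  have := comm_sum_lie_powers (power_partial_isometry_sym pAB) p_gt0 Bp0.
  have -> : \sum_(1 <= i < p) (A ^+ i * B ^+ i - B ^+ i * A ^+ i)
      = - bar_h p A B.
    by rewrite -sumrN; apply: eq_bigr => i _; rewrite opprB.
  by rewrite mulNr mulrN -opprB opprK addrC => /oppr_inj.
split.
- rewrite /lie_bracket /bar_m mulr_suml mulr_sumr -sumrB.
  apply: eq_bigr => i _; rewrite mulr_suml mulr_sumr -sumrB.
  (* Commuting the [l]-th term with [A] raises the right or the left exponent by one, giving [- f l]
     and [- f l.+1]; the ends [f i] and [f 0] form the bracket of [B ^+ i] and [A ^+ i]. *)
  pose f l := - (A ^+ l * B ^+ i * A ^+ (i - l)).
  rewrite (eq_big_nat _ _ (F2 := fun l => f l.+1 - f l)) => [|l /andP[_ lt_li]].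
    by rewrite telescope_sumr // /f subn0 subnn mul1r mulr1 opprK addrC.
  rewrite /f opprK addrC -!mulrA -exprSr !mulrA -exprS -subnDA addn1.
  by rewrite -[(i - l)%N]prednK ?subn_gt0 // -subnS.
- by rewrite [LHS]hhA scaleNr scaler_nat.
- rewrite scaler_nat; suff: ad_eigen (bar_h p A B) 2%:Z (bar_m p A B) by [].
  apply: ad_eigen_sum => i; rewrite mem_index_iota => /andP[i_gt0 _].
  apply: ad_eigen_sum => l; rewrite mem_index_iota => /andP[_ lt_li].
  (* The weights of the three factors; [l < i] keeps the truncated subtraction exact. *)
  suff -> : 2%:Z = - 2 * l%:Z + 2 * i%:Z + - 2 * (i - l - 1)%N%:Z.
    by do 2?[apply: ad_eigenM]; apply: ad_eigenX.
  by lia.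
Qed.
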